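(* Let $\mathcal{P}=(Q,\Sigma,\mathit{init},\mathit{fin},R)$ be a rendez-vous protocol and $\mathcal{N}_{\mathcal{P}}$ its associated Petri net with incidence matrix $\mathcal{A}$ and transition set $T$. Then $\mathcal{P}$ has a bounded-loss cut-off if and only if there exists a continuous firing sequence $\sigma$ of $\mathcal{N}_{\mathcal{P}}$ such that $\langle\mathit{init}\rangle$ can cover $\langle\mathit{fin}\rangle$ using $\sigma$, and the marking equation $\langle\mathit{fin}\rangle=\langle\mathit{init}\rangle+\mathcal{A}\mathbf{v}$ has a solution $\mathbf{y}\in\mathbb{Q}_{\ge0}^T$ with $\mathrm{supp}(\mathbf{y})\subseteq\mathrm{supp}(\sigma)$.
   Context: A rendez-vous protocol is $\mathcal{P}=(Q,\Sigma,\mathit{init},\mathit{fin},R)$ with finite $Q$, finite alphabet $\Sigma$, $\mathit{init},\mathit{fin}\in Q$, rules $R\subseteq Q\times\{!a,?a:a\in\Sigma\}\times Q$. Configurations are $C\in\mathbb{N}^Q$; $C\Rightarrow C'$ if there are $a\in\Sigma$ and $(p,!a,p'),(q,?a,q')\in R$ with $C\ge\langle p,q\rangle$ and $C'=C-\langle p,q\rangle+\langle p',q'\rangle$; $\xRightarrow{*}$ is the reflexive-transitive closure; $C^n_{\mathit{init}}$ has $n$ agents in $\mathit{init}$. $\mathcal{P}$ has a bounded-loss cut-off if there is $B\in\mathbb{N}$ such that for every $n$ there is $D_n$ with $C^n_{\mathit{init}}\xRightarrow{*}D_n$ and $D_n(\mathit{fin})\ge n-B$. The Petri net $\mathcal{N}_{\mathcal{P}}=(P,T,\mathrm{Pre},\mathrm{Post})$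 has $P=Q$ and, for each $a\in\Sigma$ and each pair of rules $r=(q,!a,s),r'=(q',?a,s')\in R$, a transition $t_{r,r'}$ whose column of $\mathrm{Pre}$ is the multiset $\langle q,q'\rangle$ (value $2$ at $q$ if $q=q'$, else $1$ at each) and whose column of $\mathrm{Post}$ is $\langle s,s'\rangle$; $\mathcal{A}=\mathrm{Post}-\mathrm{Pre}$. Continuous semantics: for $M\in\mathbb{Q}_{\ge0}^P$ and $\lambda\in\mathbb{Q}_{\ge0}$, $M\xrightarrow{\lambda t}_{\mathbb{Q}}M+\lambda\mathcal{A}[\cdot,t]$ provided $M(p)\ge\lambda\mathrm{Pre}[p,t]$ for all $p$; continuous firing sequences $\sigma=\lambda_1t_1\cdots\lambda_kt_k$ are fired successively; $\mathrm{supp}(\sigma)$ is the set of $t$ with $\sum_{i:t_i=t}\lambda_i\neq0$. $\langle\mathit{init}\rangle$ can cover $\langle\mathit{fin}\rangle$ using $\sigma$ if $\langle\mathit{init}\rangle\xrightarrow{\sigma}_{\mathbb{Q}}M$ for some continuous marking $M$ with $M(\mathit{fin})>0$. $\mathrm{supp}(\mathbf{y})=\{t:\mathbf{y}(t)\neq0\}$. *)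

(* Defs.v *)
From Stdlib Require Export Relation_Operators.
From mathcomp Require Export all_boot all_order all_algebra.

Set Implicit Arguments.
Unset Strict Implicit.
Unset Printing Implicit Defensive.

Import Order.TTheory GRing.Theory Num.Theory.

Local Open Scope nat_scope.

(* A message action over the alphabet S: [inl a] is !a and [inr a] is ?a. *)
Definition action (S : finType) : finType := (S + S)%type.
Definition send (S : finType) (a : S) : action S := inl a.
Definition recv (S : finType) (a : S) : action S := inr a.

Record protocol := Protocol {
  state : finType;
  letter : finType;
  init : state;
  fin : state;
  rules : {set state * action letter * state}
}.

Section RendezVous.

Variable P : protocol.

Definition rule : finType := (state P * action (letter P) * state P)%type.

Definition src (r : rule) : state P := r.1.1.
Definition act (r : rule) : action (letter P) := r.1.2.
Definition tgt (r : rule) : state P := r.2.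

Definition config := {ffun state P -> nat}.

(* The multiset <p, q>, of value 2 at p when p = q. *)
Definition pair_mset (p q : state P) : config :=
  [ffun x => (p == x) + (q == x)].

(* The subtraction is exact because of the third condition. *)
Definition step (C C' : config) : Prop :=
  exists (a : letter P) (p p' q q' : state P),
    [/\ (p, send a, p') \in rules P,
        (q, recv a, q') \in rules P,
        (forall x, pair_mset p q x <= C x) &
        C' = [ffun x => C x - pair_mset p q x + pair_mset p' q' x]].

Definition reach : config -> config -> Prop := clos_refl_trans config step.

Definition init_config (n : nat) : config :=
  [ffun x => if x == init P then n else 0].

(* [n - B] is truncated at 0, which is harmless as D (fin P) >= 0. *)
Definition has_bounded_loss_cutoff : Prop :=
  exists B : nat, forall n : nat, exists D : config,
    reach (init_config n) D /\ n - B <= D (fin P).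

End RendezVous.

Record petri_net := PetriNet {
  place : finType;
  trans : finType;
  Pre : place -> trans -> nat;
  Post : place -> trans -> nat
}.

Section AssociatedNet.

Variable P : protocol.

Definition is_rendez_vous (rr : rule P * rule P) : bool :=
  [&& rr.1 \in rules P, rr.2 \in rules P &
      [exists a : letter P, (act rr.1 == send a) && (act rr.2 == recv a)]].

Definition net_trans : finType := {rr : rule P * rule P | is_rendez_vous rr}.

Definition net_of : petri_net :=
  @PetriNet (state P) net_trans
    (fun p t => pair_mset (src (val t).1) (src (val t).2) p)
    (fun p t => pair_mset (tgt (val t).1) (tgt (val t).2) p).

End AssociatedNet.

Local Open Scope ring_scope.

Section Continuous.

Variable N : petri_net.

Definition incidence (p : place N) (t : trans N) : int :=
  (Post p t)%:Z - (Pre p t)%:Z.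

Definition marking := {ffun place N -> rat}.

Definition unit_marking (q : place N) : marking := [ffun p => (p == q)%:R].

Definition fire (M : marking) (l : rat) (t : trans N) (M' : marking) : Prop :=
  [/\ 0 <= l,
      (forall p, 0 <= M p),
      (forall p, l * (Pre p t)%:R <= M p) &
      M' = [ffun p => M p + l * (incidence p t)%:~R]].

Fixpoint fire_seq (M : marking) (s : seq (rat * trans N)) (M' : marking)
    : Prop :=
  if s is (l, t) :: s' then
    exists M1 : marking, fire M l t M1 /\ fire_seq M1 s' M'
  else M' = M.

Definition seq_supp (s : seq (rat * trans N)) : {set trans N} :=
  [set t | \sum_(lt <- s | lt.2 == t) lt.1 != 0].

Definition vec_supp (y : {ffun trans N -> rat}) : {set trans N} :=
  [set t | y t != 0].

Definition can_cover_using (p q : place N) (s : seq (rat * trans N)) : Prop :=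
  exists M : marking,
    [/\ fire_seq (unit_marking p) s M, (forall x, 0 <= M x) & 0 < M q].

Definition marking_equation (M M' : marking) (v : {ffun trans N -> rat})
    : Prop :=
  forall p, M' p = M p + \sum_(t : trans N) (incidence p t)%:~R * v t.

End Continuous.

(* Main.v *)
Require Import Defs.
From mathcomp Require Import all_boot all_order all_algebra.
From mathcomp Require Import zify ring lra.
From Stdlib Require Import Classical IndefiniteDescription.

(** If a cut-off exists, Dickson's lemma gives two runs, from [n] and from
    [m > n] agents, whose transition counts are comparable and which lose the
    same agents; the difference of the counts divided by [m - n] solves the
    marking equation, and the longer run scaled by [1/m] is the required
    continuous firing sequence.  Conversely, every place that the continuous
    sequence can mark is also marked by a discrete run from some number of
    initial agents.  Enough copies of such a run act as a catalyst: in their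
    presence an integer multiple of the solution [y] can be fired any number of
    times, each time moving [d] agents from the initial to the final state. *)

Import Order.TTheory GRing.Theory Num.Theory.
Local Open Scope ring_scope.

Set Implicit Arguments.
Unset Strict Implicit.
Unset Printing Implicit Defensive.

(** * Dickson's lemma *)

(** Past any index there is a position whose value is minimal among all later ones; jumping from one
    such position to the next gives the subsequence. *)
Lemma nondecreasing_subsequence (u : nat -> nat) :
  exists g : nat -> nat,
    (forall n, (g n < g n.+1)%N) /\
    (forall n m, (n <= m)%N -> (u (g n) <= u (g m))%N).
Proof.
have tail_min N : exists k, (N <= k)%N /\
    (forall m, (k <= m)%N -> (u k <= u m)%N).
  (* Descent on the value [u N]: restart from any later, smaller value; if there is none, [N] itself
     is a tail minimum. *)
  have [b] := ubnP (u N); elim: b N => // b IHb N ltb.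
  have [[m [leNm ltm]]|no_m] :=
    classic (exists m, (N <= m)%N /\ (u m < u N)%N).
    have [|k [lemk kmin]] := IHb m; first by lia.
    by exists k; split=> //; lia.
  exists N; split=> // m leNm; rewrite leqNgt; apply/negP => ltm.
  by apply: no_m; exists m.
have [h hP] := functional_choice _ tail_min.
pose g := fix g n := if n is n'.+1 then h (g n').+1 else h 0%N.
have g_incr n : (g n < g n.+1)%N by exact: (hP (g n).+1).1.
have g_mono : {homo g : n m / (n <= m)%N}.
  by apply: homo_leq => [||n]; [by [] | exact: leq_trans | exact: ltnW].
exists g; split=> // n m /g_mono.
by case: n => [|n]; [apply: (hP _).2 | apply: (hP (g n).+1).2].
Qed.

(** Subsequences are extracted one coordinate at a time; composing with [h] keeps the earlier
    coordinates nondecreasing. The first two terms of the last subsequence are the required pair. *)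
Lemma dickson (I : finType) (f : nat -> I -> nat) :
  exists n m, (n < m)%N /\ forall i, (f n i <= f m i)%N.
Proof.
suff [g [g_incr g_mono]] : exists g : nat -> nat,
    (forall n, (g n < g n.+1)%N) /\
    forall i, i \in enum I ->
      forall n m, (n <= m)%N -> (f (g n) i <= f (g m) i)%N.
  exists (g 0%N), (g 1%N); split=> // i.
  by apply: g_mono; rewrite ?mem_enum.
elim: (enum I) => [|i s [g [g_incr g_mono]]]; first by exists id.
have [h [h_incr h_mono]] := nondecreasing_subsequence (fun n => f (g n) i).
have homo (k : nat -> nat) : (forall n, (k n < k n.+1)%N) ->
    {homo k : n m / (n < m)%N}.
  by apply: homo_ltn; exact: ltn_trans.
exists (g \o h); split=> [n|j]; first exact: (homo g).
rewrite inE => /predU1P[-> n m|js n m lenm]; first exact: h_mono.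
apply: g_mono => //; move: lenm; rewrite leq_eqVlt => /predU1P[->//|].
by move=> /(homo _ h_incr) /ltnW.
Qed.

(** * Transition counts and clearing denominators *)

Lemma sum_count_mem (T : finType) (w : seq T) (F : T -> nat) :
  (\sum_(t <- w) F t = \sum_t count_mem t w * F t)%N.
Proof.
elim: w => [|a w IHw].
  by rewrite big_nil big1.
rewrite big_cons IHw [in RHS](bigD1 a) //= [in LHS](bigD1 a) //= eqxx.
rewrite mulnDl mul1n addnA; congr addn.
by apply: eq_bigr => t; rewrite eq_sym => /negPf->.
Qed.

Lemma exists_count_mem (T : finType) (v : T -> nat) :
  exists w : seq T, forall t, count_mem t w = v t.
Proof.
exists (flatten [seq nseq (v t) t | t <- enum T]) => t.
rewrite count_flatten -map_comp sumnE big_map big_enum /= (bigD1 t) //=.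
rewrite count_nseq /= eqxx mul1n big1 ?addn0 // => s /negPf neq_st.
by rewrite count_nseq /= neq_st.
Qed.

Lemma common_denominator (T : finType) (y : T -> rat) :
  (forall t, 0 <= y t) ->
  exists (d : nat) (v : T -> nat),
    (0 < d)%N /\ forall t, (v t)%:R = d%:R * y t.
Proof.
move=> y_ge0; exists (\prod_t `|denq (y t)|)%N.
exists (fun t => `|numq (y t)| * \prod_(s | s != t) `|denq (y s)|)%N.
split=> [|t]; first by apply: prodn_gt0 => t; rewrite absz_gt0 denq_neq0.
rewrite [in RHS](bigD1 t) //= !natrM mulrAC; congr (_ * _).
rewrite -[X in _ = _ * X](divq_num_den (y t)) mulrC.
have -> : `|numq (y t)|%:R = (numq (y t))%:~R :> rat.
  by rewrite -[LHS]/((Posz `|numq (y t)|)%:~R) gez0_abs // numq_ge0.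
have -> : `|denq (y t)|%:R = (denq (y t))%:~R :> rat.
  by rewrite -[LHS]/((Posz `|denq (y t)|)%:~R) gez0_abs // denq_ge0.
by rewrite divfK // intr_eq0 denq_neq0.
Qed.

(** * Protocol runs as firings of the net *)

Section DiscreteRuns.

Variable P : protocol.

Local Notation net := (net_of P).
Local Notation T := (trans net).
Local Notation pre x t := (Pre (p := net) x t).
Local Notation post x t := (Post (p := net) x t).

Implicit Types (C D E : config P) (x : state P) (t : T) (w : seq T).

Lemma stepP C D :
  step C D <-> exists t, (forall x, pre x t <= C x)%N /\
    D = [ffun x => C x - pre x t + post x t]%N.
Proof.
split=> [[a [p [p' [q [q' [pR qR le_C ->]]]]]]|[[[r r'] rr] [le_C ->]]].
  have rr : is_rendez_vous (((p, send a, p'), (q, recv a, q')) :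
      rule P * rule P).
    by rewrite /is_rendez_vous /= pR qR; apply/existsP; exists a; rewrite !eqxx.
  by exists (exist (fun z => is_true (is_rendez_vous z)) _ rr).
have /and3P[/= rR r'R /existsP[a /andP[/eqP act_r /eqP act_r']]] := rr.
exists a, (src r), (tgt r), (src r'), (tgt r'); split=> //.
- move: rR act_r; case: r {rr le_C r'R} => [[p b] q].
  by rewrite /act /= => + <-.
- move: r'R act_r'; case: r' {rr le_C rR} => [[p b] q].
  by rewrite /act /= => + <-.
Qed.

Lemma pre_le2 x t : (pre x t <= 2)%N.
Proof. by rewrite /= ffunE; do 2!case: (_ == _). Qed.

Lemma sum_pair_mset (p q : state P) : (\sum_x pair_mset p q x = 2)%N.
Proof.
under eq_bigr do rewrite ffunE.
rewrite big_split /= (bigD1 p) //= [X in (_ + X)%N](bigD1 q) //= !eqxx.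
by rewrite !big1 // => x /negPf; rewrite eq_sym => ->.
Qed.

Definition cadd C D : config P := [ffun x => C x + D x]%N.
Definition cscale (k : nat) C : config P := [ffun x => k * C x]%N.
Definition cunit (q : state P) : config P := [ffun x => nat_of_bool (x == q)].

Lemma reach_refl C : reach C C.
Proof. exact: rt_refl. Qed.

Lemma reach_trans C D E : reach C D -> reach D E -> reach C E.
Proof. exact: rt_trans. Qed.

Lemma reach_cadd E C D : reach C D -> reach (cadd C E) (cadd D E).
Proof.
elim=> [{}C {}D /stepP[t [le_C ->]]|{}C|C1 C2 C3 _ IH1 _ IH2].
- apply: rt_step; apply/stepP; exists t; split=> [x|].
    by rewrite ffunE; apply: leq_trans (le_C x) (leq_addr _ _).
  by apply/ffunP=> x; rewrite !ffunE; have := le_C x; rewrite /= ffunE; lia.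
- exact: rt_refl.
- exact: rt_trans IH1 IH2.
Qed.

Lemma reach_cscale k C D : reach C D -> reach (cscale k C) (cscale k D).
Proof.
move=> CD; elim: k => [|k IHk].
  suff -> : cscale 0 C = cscale 0 D by exact: rt_refl.
  by apply/ffunP=> x; rewrite !ffunE !mul0n.
have cscaleS E : cscale k.+1 E = cadd E (cscale k E).
  by apply/ffunP=> x; rewrite !ffunE mulSn.
have caddC E1 E2 : cadd E1 E2 = cadd E2 E1.
  by apply/ffunP=> x; rewrite !ffunE addnC.
(* One copy runs while the others idle; then the others run beside its result. *)
rewrite !cscaleS; apply: reach_trans (reach_cadd _ CD) _.
by rewrite ![cadd D _]caddC; apply: reach_cadd.
Qed.

Lemma reach_mass C D : reach C D -> (\sum_x D x = \sum_x C x)%N.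
Proof.
elim=> [{}C {}D [a [p [p' [q [q' [_ _ le_C ->]]]]]]|//|C1 C2 C3 _ <- _ <- //].
apply: (@addIn (\sum_x pair_mset p q x)).
rewrite [in RHS](sum_pair_mset p q) -(sum_pair_mset p' q') -!big_split /=.
by apply: eq_bigr => x _; rewrite !ffunE; have := le_C x; rewrite !ffunE; lia.
Qed.

(** A firing removes at most two agents from a place, so with this many agents in every input place
    [w] can be fired in the given order, even without using the agents it produces. *)
Lemma fire_all w C :
  (forall t, t \in w -> forall x, (0 < pre x t)%N -> (2 * size w <= C x)%N) ->
  exists D, reach C D /\
    forall x, (D x + \sum_(t <- w) pre x t = C x + \sum_(t <- w) post x t)%N.
Proof.
elim: w C => [|t w IHw] C C_big.
  by exists C; split=> [|x]; [exact: rt_refl | rewrite !big_nil].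
have le_C x : (pre x t <= C x)%N.
  have [->//|pre_gt0] := posnP (pre x t).
  apply: leq_trans (pre_le2 x t) _.
  apply: leq_trans (C_big t (mem_head _ _) x pre_gt0).
  by rewrite /= mulnS leq_addr.
pose C1 : config P := [ffun x => C x - pre x t + post x t]%N.
have [s sw x pre_gt0|D [C1D eqD]] := IHw C1.
  have s_tw : s \in t :: w by rewrite inE sw orbT.
  have := C_big s s_tw x pre_gt0; have := pre_le2 x t.
  rewrite [C1 x]ffunE -[size (t :: w)]/((size w).+1).
  by move: (size w) (pre x t) (post x t) => k i o; lia.
exists D; split=> [|x].
  by apply: reach_trans C1D; apply: rt_step; apply/stepP; exists t.
by rewrite !big_cons; have := eqD x; rewrite [C1 x]ffunE; have := le_C x; lia.
Qed.

(** * Places marked by discrete runs *)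

Definition markable (U : {set state P}) :=
  exists (k : nat) (L : config P),
    reach (init_config P k) L /\ forall x, x \in U -> (0 < L x)%N.

Lemma markable_init : markable [set init P].
Proof.
exists 1%N, (init_config P 1); split=> [|x]; first exact: rt_refl.
by rewrite inE ffunE => ->.
Qed.

Lemma markable_fire (U : {set state P}) t :
  markable U -> (forall x, (0 < pre x t)%N -> x \in U) ->
  markable (U :|: [set x | 0 < post x t]%N).
Proof.
move=> [k [L [kL L_gt0]]] preU.
(* Three copies: firing [t] removes at most two agents from any place. *)
exists (3 * k)%N, [ffun x => 3 * L x - pre x t + post x t]%N; split.
  have -> : init_config P (3 * k) = cscale 3 (init_config P k).
    by apply/ffunP=> x; rewrite !ffunE; case: (_ == _).
  apply: reach_trans (reach_cscale 3 kL) _.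
  apply: rt_step; apply/stepP; exists t; split=> [x|].
    rewrite ffunE; have [->//|pre_gt0] := posnP (pre x t).
    by have := L_gt0 _ (preU _ pre_gt0); have := pre_le2 x t; lia.
  by apply/ffunP=> x; rewrite !ffunE.
move=> x; rewrite !inE ffunE => /orP[/L_gt0|]; have := pre_le2 x t; lia.
Qed.

(** Along the sequence, [U] is kept markable and containing all places marked so far; a firing of
    positive weight has its inputs in [U], and its outputs are added to [U]. *)
Lemma markable_pre_supp s (M M' : marking net) (U : {set state P}) :
  fire_seq M s M' -> markable U -> (forall x, 0 < M x -> x \in U) ->
  exists V : {set state P}, [/\ markable V, U \subset V &
    forall t, t \in seq_supp s -> forall x, (0 < pre x t)%N -> x \in V].
Proof.
elim: s M U => [|[l t] s IHs] M U /=.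
  by move=> _ mU _; exists U; split=> // t; rewrite inE big_nil eqxx.
move=> [M1 [[l_ge0 M_ge0 le_M ->] {}/IHs IHs]] mU MU.
(* A firing of weight zero may have empty input places; it is skipped, as it changes neither the
   marking nor the support. *)
have [l0|l_neq0] := eqVneq l 0.
  have [//|x|V [mV UV suppV]] := IHs U.
    by rewrite ffunE l0 mul0r addr0; apply: MU.
  exists V; split=> // u; rewrite inE big_cons /= l0 add0r if_same => us.
  by apply: suppV; rewrite inE.
have l_gt0 : 0 < l by rewrite lt_def l_neq0.
have preU x : (0 < pre x t)%N -> x \in U.
  move=> pre_gt0; apply: MU; apply: lt_le_trans (le_M x).
  by rewrite mulr_gt0 // ltr0n.
have [|x|V [mV UV suppV]] := IHs (U :|: [set x | 0 < post x t]%N).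
- exact: markable_fire.
- rewrite ffunE !inE => M1_gt0; apply/orP.
  (* A place that was empty and receives no agents has nonpositive incidence, so it cannot become
     marked. *)
  have [|M_le0] := ltP 0 (M x); first by left; apply: MU.
  right; rewrite lt0n; apply/eqP => post0; move: M1_gt0; rewrite ltNge => /negP.
  apply; rewrite -[leRHS]addr0 lerD // mulr_ge0_le0 // lerz0.
  by rewrite /incidence post0 sub0r oppr_le0.
exists V; split=> // [|u].
  by apply: subset_trans UV; apply: subsetUl.
rewrite inE big_cons /=; case: (eqVneq t u) => [<- _ x /preU xU|_ us].
  by apply: (subsetP UV); rewrite inE xU.
by apply: suppV; rewrite inE.
Qed.

(** * From runs to continuous sequences and the marking equation *)

Definition scaled (e : rat) C : marking net := [ffun x => e * (C x)%:R].

Lemma incidenceE x t :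
  (incidence (N := net) x t)%:~R = (post x t)%:R - (pre x t)%:R :> rat.
Proof. exact: rmorphB. Qed.

Lemma reach_run C D : reach C D ->
  exists w, (forall x,
      D x + \sum_(t <- w) pre x t = C x + \sum_(t <- w) post x t)%N /\
    forall e, 0 <= e ->
      fire_seq (scaled e C) [seq (e, t) | t <- w] (scaled e D).
Proof.
move=> CD; elim: {CD}(Operators_Properties.clos_rt_rt1n _ _ _ _ CD) =>
    [{}C|{}C C1 {}D /stepP[t [le_C ->]] _ [w [eqD fire_w]]].
  by exists [::]; split=> // x; rewrite !big_nil.
exists (t :: w); split=> [x|e e_ge0].
  rewrite !big_cons; have := eqD x; rewrite ffunE; have := le_C x; lia.
have e_ge := ler_wpM2l e_ge0.
exists (scaled e [ffun x => C x - pre x t + post x t]%N).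
split; last exact: fire_w.
split=> // [x|x|].
- by rewrite ffunE mulr_ge0.
- by rewrite ffunE e_ge // ler_nat.
apply/ffunP=> x; rewrite !ffunE -mulrDr; congr (_ * _).
rewrite incidenceE /= natrD natrB ?ffunE //; last first.
  by have := le_C x; rewrite /= ffunE.
by rewrite addrA addrAC.
Qed.

Lemma sum_incidence C D w x :
  (D x + \sum_(t <- w) pre x t = C x + \sum_(t <- w) post x t)%N ->
  \sum_(t : T) (incidence (N := net) x t)%:~R * (count_mem t w)%:R
    = (D x)%:R - (C x)%:R :> rat.
Proof.
rewrite !(sum_count_mem w) => /(congr1 (fun k => k%:R : rat)).
rewrite !natrD !natr_sum => eqD.
have swap (a b c d : rat) : a + b = c + d -> a - c = d - b by lra.
rewrite (swap _ _ _ _ eqD) -sumrB; apply: eq_bigr => t _; rewrite incidenceE.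
by move: (pre x t) (post x t) (count_mem t w) => i o c; rewrite !natrM; ring.
Qed.

Lemma seq_supp_const (e : rat) w t :
  0 < e -> t \in w -> t \in seq_supp (N := net) [seq (e, u) | u <- w].
Proof.
move=> e_gt0 tw; rewrite inE big_map /= big_const_seq iter_addr_0 mulrn_eq0.
by rewrite negb_or (gt_eqF e_gt0) andbT -lt0n -has_count has_pred1.
Qed.

Lemma sum_init_config n : (\sum_x init_config P n x = n)%N.
Proof.
rewrite (bigD1 (init P)) //= ffunE eqxx big1 ?addn0 // => x /negPf x_init.
by rewrite ffunE x_init.
Qed.

(** Agents are conserved, so at most [B] of them lie outside [fin P]; for [n < B] the total is
    already below [B]. *)
Lemma loss_le_bound n B D x :
  reach (init_config P n) D -> (n - B <= D (fin P))%N -> x != fin P ->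
  (D x <= B)%N.
Proof.
move=> /reach_mass; rewrite sum_init_config => mass D_fin x_fin.
by move: mass; rewrite (bigD1 (fin P)) //= (bigD1 x) //=; lia.
Qed.

End DiscreteRuns.

Theorem theorem6p2 (P : protocol) :
  has_bounded_loss_cutoff P <->
  exists sigma : seq (rat * trans (net_of P)),
    can_cover_using (N := net_of P) (init P) (fin P) sigma /\
    exists y : {ffun trans (net_of P) -> rat},
      [/\ forall t, 0 <= y t,
          marking_equation (N := net_of P)
            (unit_marking (N := net_of P) (init P))
            (unit_marking (N := net_of P) (fin P)) y &
          vec_supp y \subset seq_supp sigma].
Proof.
split=> [[B cutoff]|[sigma [[M [fire_sigma _ _]] [y [y_ge0 eq_y supp_y]]]]].

  (* From a cut-off to a sequence and a solution *)
  (* [N k] exceeds [B], so each run marks [fin P]; moreover [N m - N n = m - n]. *)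
  pose N k := (k + B).+1.
  have /functional_choice[run run_spec] :
    forall k, exists Dw : config P * seq (net_trans P),
      [/\ reach (init_config P (N k)) Dw.1, (N k - B <= Dw.1 (fin P))%N,
          forall x, (Dw.1 x + \sum_(t <- Dw.2) Pre (p := net_of P) x t =
            init_config P (N k) x +
            \sum_(t <- Dw.2) Post (p := net_of P) x t)%N &
          forall e, 0 <= e -> fire_seq (scaled e (init_config P (N k)))
            [seq (e, t) | t <- Dw.2] (scaled e Dw.1)].
    move=> k; have [D [CD D_fin]] := cutoff (N k).
    by have [w [eqD fire_w]] := reach_run CD; exists (D, w).
  pose loss k x := if x == fin P then 0%N else (run k).1 x.
  have loss_le k x : (loss k x <= B)%N.
    rewrite /loss; case: ifPn => // x_fin; have [CD D_fin _ _] := run_spec k.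
    exact: loss_le_bound CD D_fin x_fin.
  (* Comparing both the losses and their complements to [B] makes them equal. *)
  pose f k (i : net_trans P + (state P + state P)) : nat := match i with
    | inl t => count_mem t (run k).2
    | inr (inl x) => loss k x
    | inr (inr x) => (B - loss k x)%N
    end.
  have [n [m [lt_nm le_f]]] := dickson f.
  have eq_loss x : loss n x = loss m x.
    have := le_f (inr (inl x)); have := le_f (inr (inr x)) => /=.
    by have := loss_le n x; have := loss_le m x; lia.
  have le_count t : (count_mem t (run n).2 <= count_mem t (run m).2)%N.
    exact: le_f (inl t).
  have [_ _ eqDn _] := run_spec n; have [_ Dm_fin eqDm fire_m] := run_spec m.
  have total_loss k :
      ((run k).1 (fin P) + \sum_(x | x != fin P) loss k x = N k)%N.
    have [CD _ _ _] := run_spec k.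
    rewrite -(sum_init_config P (N k)) -(reach_mass CD).
    rewrite [RHS](bigD1 (fin P)) //=.
    by congr addn; apply: eq_bigr => x /negPf x_fin; rewrite /loss x_fin.
  (* The losses agree, so by conservation all [m - n] extra agents end in [fin P]. *)
  have eqD x : ((run m).1 x = (run n).1 x + (m - n) * (x == fin P))%N.
    have [->|x_fin] := eqVneq x (fin P); last first.
      by have := eq_loss x; rewrite /loss (negPf x_fin) muln0 addn0.
    have := total_loss n; have := total_loss m.
    rewrite (eq_bigr (loss n)) => [|z _]; last by rewrite eq_loss.
    by rewrite /N; move: (\sum_(z | _) _)%N => r; lia.
  have e_gt0 : 0 < (N m)%:R^-1 :> rat by rewrite invr_gt0 ltr0n.
  have d_gt0 : 0 < (m - n)%:R :> rat by rewrite ltr0n subn_gt0.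
  exists [seq ((N m)%:R^-1, t) | t <- (run m).2]; split.
    exists (scaled (N m)%:R^-1 (run m).1); split=> [|x|].
    - suff <- : scaled (N m)%:R^-1 (init_config P (N m)) =
          unit_marking (N := net_of P) (init P) by apply/fire_m/ltW.
      apply/ffunP=> x; rewrite !ffunE.
      by case: eqP => _; rewrite ?mulr0 // mulVf // pnatr_eq0.
    - by rewrite ffunE mulr_ge0 // ltW.
    - rewrite ffunE mulr_gt0 // ltr0n; apply: leq_trans Dm_fin.
      by rewrite /N; lia.
  exists [ffun t => (count_mem t (run m).2 - count_mem t (run n).2)%:R
                    / (m - n)%:R].
  split=> [t|x|].
  - by rewrite ffunE mulr_ge0 // invr_ge0 ltW.
  - rewrite !ffunE; apply: (mulfI (lt0r_neq0 d_gt0)).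
    rewrite mulrDr mulr_sumr.
    under eq_bigr => t _.
      rewrite ffunE mulrCA [X in _ * X]mulrC divfK ?lt0r_neq0 //.
      rewrite (natrB _ (le_count t)) mulrBr.
      over.
    rewrite sumrB (sum_incidence (eqDm x)) (sum_incidence (eqDn x)) eqD.
    rewrite !ffunE natrD natrM natrB ?(ltnW lt_nm) // /N.
    case: (x == init P); rewrite ?mulr0 ?mulr1 -?addnS ?natrD; lra.
  apply/subsetP=> t; rewrite inE ffunE => y_neq0.
  apply: seq_supp_const => //; rewrite -has_pred1 has_count.
  by rewrite lt0n; apply: contra_neq y_neq0 => ->; rewrite sub0n mul0r.

(* From a sequence and a solution to a cut-off *)
have U_init x :
    0 < unit_marking (N := net_of P) (init P) x -> x \in [set init P].
  by rewrite ffunE inE; case: (x == init P); rewrite ?ltxx.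
have [U [[k [L [kL L_gt0]]] _ suppU]] :=
  markable_pre_supp fire_sigma (markable_init P) U_init.
have [d [v [d_gt0 vE]]] := common_denominator y_ge0.
have [w wE] := exists_count_mem v.
(* The catalyst: [L] marks all of [U], and [2 * size w] copies meet the bound of [fire_all]. *)
pose cat := cscale (2 * size w) L.
have [|D [CD eqD]] := @fire_all P w (cadd (cscale d (cunit (init P))) cat).
  move=> t tw x pre_gt0; rewrite !ffunE.
  (* A transition occurring in [w] has [y t] nonzero, hence lies in the support of [sigma], whose
     input places are in [U]. *)
  have : x \in U.
    apply: suppU pre_gt0; apply: (subsetP supp_y); rewrite inE.
    apply: contraTneq tw => y0; have := vE t; rewrite y0 mulr0 => /eqP.
    by rewrite pnatr_eq0 -wE => /eqP/count_memPn.
  by move=> /L_gt0; nia.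
(* The counts of [w] are [d * y], so by the marking equation [w] moves [d] agents from [init P] to
   [fin P] and restores the catalyst. *)
have {}eqD : D = cadd (cscale d (cunit (fin P))) cat.
  apply/ffunP=> x; have := sum_incidence (eqD x).
  under eq_bigr do rewrite wE vE mulrCA.
  have -> : \sum_t d%:R * ((incidence (N := net_of P) x t)%:~R * y t) =
      d%:R * ((x == fin P)%:R - (x == init P)%:R).
    have := eq_y x; rewrite -mulr_sumr !ffunE => ->.
    by rewrite addrAC subrr add0r.
  rewrite !ffunE natrD natrM => eqDx; apply/eqP.
  by rewrite -(eqr_nat rat) natrD natrM; apply/eqP; lra.
rewrite {D}eqD in CD.
(* The bystanders [E] are arbitrary so that the induction can absorb into them the agents already
   moved. *)
have loop j E : reach (cadd (cscale (j * d) (cunit (init P))) (cadd cat E))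
    (cadd (cscale (j * d) (cunit (fin P))) (cadd cat E)).
  elim: j E => [|j IHj] E.
    suff -> : cscale (0 * d) (cunit (init P)) = cscale (0 * d) (cunit (fin P))
      by exact: reach_refl.
    by apply/ffunP=> x; rewrite !ffunE.
  have split_loop a : cadd (cscale (j.+1 * d) a) (cadd cat E) =
      cadd (cadd (cscale d a) cat) (cadd (cscale (j * d) a) E).
    by apply/ffunP=> x; rewrite !ffunE; lia.
  rewrite !split_loop; apply: reach_trans (reach_cadd _ CD) _.
  have swap a : cadd (cadd (cscale d (cunit (fin P))) cat) (cadd a E) =
      cadd a (cadd cat (cadd (cscale d (cunit (fin P))) E)).
    by apply/ffunP=> x; rewrite !ffunE; lia.
  by rewrite !swap; apply: IHj.
(* Building the catalyst takes [c] agents. The rest move in batches of [d], leaving fewer than [d]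
   behind, so at most [c + d] are lost; for [n < c] nothing needs to move. *)
pose c := (2 * size w * k)%N.
exists (c + d)%N => n; have [lt_n|le_n] := ltnP n c.
  by exists (init_config P n); split; [exact: reach_refl | lia].
pose j := ((n - c) %/ d)%N; pose r := cscale ((n - c) %% d) (cunit (init P)).
exists (cadd (cscale (j * d) (cunit (fin P))) (cadd cat r)); split.
  apply: reach_trans (loop j r).
  have -> : init_config P n = cadd (cscale (2 * size w) (init_config P k))
      (cadd (cscale (j * d) (cunit (init P))) r).
    apply/ffunP=> x; rewrite !ffunE; have := divn_eq (n - c) d.
    by rewrite /j /c; case: (x == init P); lia.
  have -> : cadd (cscale (j * d) (cunit (init P))) (cadd cat r) =
      cadd cat (cadd (cscale (j * d) (cunit (init P))) r).
    by apply/ffunP=> x; rewrite !ffunE; lia.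
  exact/reach_cadd/reach_cscale.
rewrite !ffunE eqxx muln1; have := divn_eq (n - c) d.
by have := ltn_pmod (n - c) d_gt0; rewrite -/j; lia.
Qed.
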